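(* Suppose that $\theta\in(0,\pi)$ has a rational cosine, $\cos\theta=s/r$ with $r,s\in\mathbb{Z}$, $0\le |s|<r$ and $\gcd(r,s)=1$, and that $(a_0,b_0,c_0)$ is a rational $\theta$-triple for a $\theta$-congruent number $N$. If $b_0^2-a_0^2\neq 0$, then $(a_1,b_1,c_1)$ given by $$a_1=\frac{c_0^4-4(r^2-s^2)a_0^2b_0^2/r^2+4s\,a_0b_0c_0^2/r}{2c_0(b_0^2-a_0^2)},\qquad b_1=\frac{4c_0^2a_0b_0}{2c_0(b_0^2-a_0^2)},\qquad c_1=\frac{c_0^4+4(r^2-s^2)a_0^2b_0^2/r^2}{2c_0(b_0^2-a_0^2)}$$ is another rational $\theta$-triple for $N$. It is different from $(a_0,b_0,c_0)$ provided that $b_0^2-a_0^2\neq 2a_0c_0$. In particular, $(|a_1|,|b_1|,|c_1|)$ is a rational $\theta$-triangle for $N$.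
   Context: Fix $\theta\in(0,\pi)$ with $\cos\theta=s/r$, $r,s\in\mathbb{Z}$, $0\le|s|<r$, $\gcd(r,s)=1$. For a positive integer $N$, a rational $\theta$-triple for $N$ is a triple $(a,b,c)$ of rational numbers (not necessarily positive) with $a^2+b^2-\frac{2s}{r}ab=c^2$ and $ab=2rN$. The $\theta$-triples $(a,b,c)$ and $(b,a,c)$ are identified, since these equations are symmetric in $a$ and $b$. A rational $\theta$-triangle for $N$ is a rational $\theta$-triple for $N$ with $a,b,c>0$. A positive integer $N$ is a $\theta$-congruent number if there exists a rational $\theta$-triangle for $N$ (equivalently, a triangle with rational sides $a,b,c$, angle $\theta$ between the sides $a$ and $b$, and area $N\sqrt{r^2-s^2}$). *)

(* Defs.v *)
From mathcomp Require Import all_boot all_order all_algebra.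

Set Implicit Arguments.
Unset Strict Implicit.
Unset Printing Implicit Defensive.

Import Order.TTheory GRing.Theory Num.Theory.

Local Open Scope ring_scope.

(* The integers r and s encode the angle theta, through cos theta = s / r in
   lowest terms with r > 0; they are determined by theta. *)
Definition theta_triple (r s : int) (N : nat) (t : rat * rat * rat) : Prop :=
  let: (a, b, c) := t in
  a ^+ 2 + b ^+ 2 - 2 * s%:Q / r%:Q * a * b = c ^+ 2
  /\ a * b = 2 * r%:Q * N%:R.

Definition theta_triangle (r s : int) (N : nat) (t : rat * rat * rat) : Prop :=
  theta_triple r s N t /\ (let: (a, b, c) := t in [/\ 0 < a, 0 < b & 0 < c]).

Definition theta_congruent (r s : int) (N : nat) : Prop :=
  (0 < N)%N /\ exists t : rat * rat * rat, theta_triangle r s N t.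

(* Equality of triples up to the identification of (a, b, c) with (b, a, c). *)
Definition same_triple (t u : rat * rat * rat) : Prop :=
  let: (a, b, c) := t in u = (a, b, c) \/ u = (b, a, c).

(* Main.v *)
Require Import Defs.
From mathcomp Require Import all_boot all_order all_algebra.
From mathcomp Require Import reals trigo.
From mathcomp Require Import ring lra.

(** Write k = cos theta and d = b^2 - a^2.  The law of cosines
    c^2 = a^2 + b^2 - 2 k a b gives

      d^2 = (a^2 + b^2)^2 - 4 a^2 b^2 = (c^2 + 2 k a b)^2 - 4 a^2 b^2,

    and the right-hand side is exactly the numerator of a1
    ([sqrB_cosine_law]).  The new triple therefore has the short form

      a1 = d / (2 c),   b1 = 2 a b c / d,   c1 = c (a^2 + b^2) / d - a1,

    from which a1 b1 = a b, so that the area is preserved, and the law of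
    cosines for (a1, b1, c1) is a rational identity ([double_cosine_law]).

    With the short form, a1 = a means d = 2 a c, the excluded case.  The
    exchanged coincidence (a1, b1, c1) = (b, a, c) never happens: a1 = b means
    d = 2 b c, and then c1 = c forces a^2 = b^2 ([double_neq_swap]).

    Positivity rests on the form x^2 + y^2 - 2 k x y being positive definite
    for |k| < 1 ([cosine_form_gt0]): it makes c nonzero, so that the formulas
    make sense, and then c1 nonzero.  Finally a1 b1 = a b = 2 r N is positive,
    so passing to absolute values changes neither the product nor the form. *)

Set Implicit Arguments.
Unset Strict Implicit.
Unset Printing Implicit Defensive.

Import Order.TTheory GRing.Theory Num.Theory.

Local Open Scope ring_scope.

Section Doubling.

Variables (F : realFieldType) (k : F).

(** Completing the square: the form is (x - k y)^2 + (1 - k^2) y^2. *)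
Lemma cosine_form_gt0 (x y : F) :
  `|k| < 1 -> y != 0 -> 0 < x ^+ 2 + y ^+ 2 - 2 * k * x * y.
Proof.
move=> k_lt1 y_neq0.
have k2_lt1 : k ^+ 2 < 1 by rewrite -real_normK ?num_real // expr_lt1.
have -> : x ^+ 2 + y ^+ 2 - 2 * k * x * y
          = (x - k * y) ^+ 2 + (1 - k ^+ 2) * y ^+ 2 by ring.
by rewrite ltr_wpDl ?sqr_ge0 // mulr_gt0 ?subr_gt0 // exprn_even_gt0.
Qed.

Variables a b c : F.
Hypothesis cos_law : a ^+ 2 + b ^+ 2 - 2 * k * a * b = c ^+ 2.

(** The numerator of a1 is a square; this is what makes the doubled triple
    have the same area as the original one. *)
Lemma sqrB_cosine_law :
  c ^+ 4 - 4 * (1 - k ^+ 2) * a ^+ 2 * b ^+ 2 + 4 * k * a * b * c ^+ 2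
  = (b ^+ 2 - a ^+ 2) ^+ 2.
Proof.
have -> : c ^+ 4 = (c ^+ 2) ^+ 2 by ring.
by rewrite -cos_law; ring.
Qed.

(** The numerator of c1: by [sqrB_cosine_law],
    4 (1 - k^2) a^2 b^2 = c^2 (c^2 + 4 k a b) - d^2, while
    c^2 + 2 k a b = a^2 + b^2. *)
Lemma double_hyp_numerator :
  c ^+ 4 + 4 * (1 - k ^+ 2) * a ^+ 2 * b ^+ 2
  = 2 * c ^+ 2 * (a ^+ 2 + b ^+ 2) - (b ^+ 2 - a ^+ 2) ^+ 2.
Proof.
have -> : c ^+ 4 = (c ^+ 2) ^+ 2 by ring.
by rewrite -cos_law; ring.
Qed.

Let d := b ^+ 2 - a ^+ 2.
Let a1 := d / (2 * c).
Let b1 := 2 * a * b * c / d.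
Let c1 := c * (a ^+ 2 + b ^+ 2) / d - a1.

Hypotheses (c_neq0 : c != 0) (d_neq0 : d != 0).

Lemma double_mul : a1 * b1 = a * b.
Proof. by rewrite /a1 /b1; field; rewrite c_neq0 d_neq0. Qed.

(** Expanding c1^2, the square of a1 cancels, and the rest reduces to
    (a^2 + b^2)^2 = d^2 + 4 a^2 b^2 and to the original law of cosines. *)
Lemma double_cosine_law : a1 ^+ 2 + b1 ^+ 2 - 2 * k * a1 * b1 = c1 ^+ 2.
Proof.
have k2ab : 2 * k * a * b = a ^+ 2 + b ^+ 2 - c ^+ 2 by rewrite -cos_law; ring.
rewrite -(mulrA (2 * k)) double_mul mulrA k2ab /c1 /a1 /b1.
have sqrB_neq0 : b ^+ 2 - a ^+ 2 != 0 := d_neq0.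
by rewrite /d; field; rewrite c_neq0 sqrB_neq0.
Qed.

Lemma double_eq_leg (x : F) : a1 = x -> d = 2 * x * c.
Proof. by move=> <-; rewrite /a1; field. Qed.

(** With d = 2 b c, clearing denominators in c1 = c leaves
    a^2 + b^2 = 2 b (b + c) = 2 b^2 + d = 3 b^2 - a^2, so a^2 = b^2. *)
Lemma double_neq_swap : a1 = b -> c1 <> c.
Proof.
move=> a1b c1c; have d_eq := double_eq_leg a1b.
have hyp : c * (a ^+ 2 + b ^+ 2) = c * (2 * b * (b + c)).
  transitivity ((c1 + a1) * d); first by rewrite /c1; field.
  by rewrite c1c a1b d_eq; ring.
move/(mulfI c_neq0): hyp => hyp.
case/eqP: d_neq0; rewrite /d in d_eq *; lra.
Qed.

End Doubling.

Section ThetaTriples.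

Variables (r s : int) (N : nat).

Lemma abs_cos_lt1 : `|s| < r -> `|s%:Q / r%:Q| < 1.
Proof.
move=> s_lt_r; have r_gt0 : 0 < r by apply: le_lt_trans s_lt_r.
have rQ_gt0 : 0 < r%:Q by rewrite ltr0z.
by rewrite normrM normfV (gtr0_norm rQ_gt0) ltr_pdivrMr // mul1r -intr_norm ltr_int.
Qed.

Lemma theta_triple_hyp_neq0 (a b c : rat) :
  `|s| < r -> b != 0 -> theta_triple r s N (a, b, c) -> c != 0.
Proof.
move=> /abs_cos_lt1 k_lt1 b_neq0 [cos_law _].
have := cosine_form_gt0 a k_lt1 b_neq0.
rewrite mulrA cos_law; case: eqP => // ->.
by rewrite expr0n ltxx.
Qed.

(** The legs have positive product, hence equal signs, so taking absolute
    values preserves their product and the law of cosines. *)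
Lemma theta_triangle_norm (a b c : rat) :
  (0 < N)%N -> `|s| < r -> theta_triple r s N (a, b, c) ->
  theta_triangle r s N (`|a|, `|b|, `|c|).
Proof.
move=> N_gt0 s_lt_r abcP; have [cos_law area] := abcP.
have r_gt0 : 0 < r by apply: le_lt_trans s_lt_r.
have ab_gt0 : 0 < a * b by rewrite area !mulr_gt0 ?ltr0z ?ltr0n.
have [a_neq0 b_neq0] : a != 0 /\ b != 0.
  by apply/andP; rewrite -negb_or -mulf_eq0 gt_eqF.
have c_neq0 := theta_triple_hyp_neq0 s_lt_r b_neq0 abcP.
have norm_ab : `|a| * `|b| = a * b by rewrite -normrM gtr0_norm.
split; last by rewrite !normr_gt0.
split; last by rewrite norm_ab.
by rewrite -(mulrA _ `|a|) norm_ab mulrA !real_normK ?num_real.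
Qed.

End ThetaTriples.

Theorem theorem3p2 (R : realType) (theta : R) (r s : int) (N : nat)
  (a0 b0 c0 : rat)
  (htheta : 0 < theta < pi)
  (hcos : cos theta = s%:~R / r%:~R)
  (hsr : 0 <= `|s| < r)
  (hcop : coprimez r s)
  (hN : theta_congruent r s N)
  (h0 : theta_triple r s N (a0, b0, c0))
  (hne : b0 ^+ 2 - a0 ^+ 2 != 0) :
  let a1 : rat :=
    (c0 ^+ 4
     - 4 * (r%:Q ^+ 2 - s%:Q ^+ 2) * a0 ^+ 2 * b0 ^+ 2 / r%:Q ^+ 2
     + 4 * s%:Q * a0 * b0 * c0 ^+ 2 / r%:Q)
    / (2 * c0 * (b0 ^+ 2 - a0 ^+ 2)) in
  let b1 : rat :=
    (4 * c0 ^+ 2 * a0 * b0) / (2 * c0 * (b0 ^+ 2 - a0 ^+ 2)) in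
  let c1 : rat :=
    (c0 ^+ 4
     + 4 * (r%:Q ^+ 2 - s%:Q ^+ 2) * a0 ^+ 2 * b0 ^+ 2 / r%:Q ^+ 2)
    / (2 * c0 * (b0 ^+ 2 - a0 ^+ 2)) in
  [/\ theta_triple r s N (a1, b1, c1),
      b0 ^+ 2 - a0 ^+ 2 != 2 * a0 * c0 ->
        ~ same_triple (a0, b0, c0) (a1, b1, c1)
    & theta_triangle r s N (`|a1|, `|b1|, `|c1|)].
Proof.
move=> a1 b1 c1.
have [_ s_lt_r] := andP hsr.
have [N_gt0 _] := hN.
have [cos_law0 area] := h0.
have r_gt0 : 0 < r by apply: le_lt_trans s_lt_r.
have rQ_neq0 : r%:Q != 0 by rewrite intr_eq0 gt_eqF.
have b0_neq0 : b0 != 0.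
  have : a0 * b0 != 0 by rewrite area gt_eqF // !mulr_gt0 ?ltr0z ?ltr0n.
  by rewrite mulf_eq0 negb_or => /andP[].
have c0_neq0 := theta_triple_hyp_neq0 s_lt_r b0_neq0 h0.
pose k := s%:Q / r%:Q.
have cos_law : a0 ^+ 2 + b0 ^+ 2 - 2 * k * a0 * b0 = c0 ^+ 2.
  by rewrite -cos_law0 /k mulrA.
have a1E : a1 = (b0 ^+ 2 - a0 ^+ 2) / (2 * c0).
  transitivity ((b0 ^+ 2 - a0 ^+ 2) ^+ 2 / (2 * c0 * (b0 ^+ 2 - a0 ^+ 2))).
    rewrite -(sqrB_cosine_law cos_law) /a1 /k; congr (_ / _).
    by field.
  by field; rewrite c0_neq0 hne.
have b1E : b1 = 2 * a0 * b0 * c0 / (b0 ^+ 2 - a0 ^+ 2).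
  by rewrite /b1; field; rewrite c0_neq0 hne.
have c1E : c1 = c0 * (a0 ^+ 2 + b0 ^+ 2) / (b0 ^+ 2 - a0 ^+ 2)
                - (b0 ^+ 2 - a0 ^+ 2) / (2 * c0).
  transitivity ((2 * c0 ^+ 2 * (a0 ^+ 2 + b0 ^+ 2) - (b0 ^+ 2 - a0 ^+ 2) ^+ 2)
                / (2 * c0 * (b0 ^+ 2 - a0 ^+ 2))).
    rewrite -(double_hyp_numerator cos_law) /c1 /k; congr (_ / _).
    by field.
  by field; rewrite c0_neq0 hne.
have double_triple : theta_triple r s N (a1, b1, c1).
  rewrite a1E b1E c1E; split; last by rewrite double_mul.
  by rewrite -(mulrA 2 s%:Q) -/k; apply: double_cosine_law.
split=> //; last exact: theta_triangle_norm.
move=> neq_2ac; rewrite /same_triple a1E b1E c1E => -[] [a1_eq _ c1_eq].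
  by move: neq_2ac; rewrite (double_eq_leg c0_neq0 a1_eq) eqxx.
exact: (double_neq_swap c0_neq0 hne a1_eq c1_eq).
Qed.
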